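(* Let $a=(a_1,a_2,\dots)$ be an infinite sequence of positive integers and let $k\ge 2$ be an integer such that $\gcd(a_1,\dots,a_k)=1$. Put $d_i=\gcd(a_1,\dots,a_i)$ for $i\ge 1$ and define the sequence $s^-_i$ ($i\ge1$) by $$s^-_1=-a_1,\qquad s^-_{i+1}=s^-_i+\left(\frac{d_i}{d_{i+1}}-1\right)a_{i+1}.$$ Then for every integer $n\ge 0$ with $n\ge s^-_k$, $$D^a_k(n)\ \ge\ \frac{1}{\prod_{i=1}^{k}a_i}\sum_{i=0}^{k-2}B^a_2(k-2,i)\,\frac{(n-s^-_k)^{k-1-i}}{(k-1-i)!},$$ where $B^a_2(k-2,i)$ denotes the Blom–Fröberg number with $r=2$.
   Context: For an infinite sequence $a=(a_1,a_2,\dots)$ of positive integers, an integer $k\ge1$ and an integer $n\ge 0$, the denumerant $D^a_k(n)$ is the number of $k$-tuples $(x_1,\dots,x_k)$ of non-negative integers with $a_1x_1+\dots+a_kx_k=n$. For such $a$, an integer $r\ge0$ and integers $m,\ell\in\mathbb{Z}$, the Blom–Fröberg number $B^a_r(m,\ell)$ is defined recursively by: $B^a_r(m,\ell)=0$ if $\ell<0$ or $\ell>m$; $B^a_r(0,0)=1$; and otherwise $$B^a_r(m,\ell)=B^a_r(m-1,\ell)+\frac{a_{m+r}}{2}\,B^a_r(m-1,\ell-1).$$ *)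

(* Defs.v *)
From mathcomp Require Import all_boot all_order all_algebra.

Set Implicit Arguments.
Unset Strict Implicit.
Unset Printing Implicit Defensive.

Import Order.TTheory GRing.Theory Num.Theory.

(* A sequence a_1, a_2, ... is represented by a : nat -> nat; the value a 0 is
   never used. *)

(* The unknowns x_1, ..., x_k are x 0, ..., x (k - 1). Bounding them by n loses
   no solution when the a_i are positive: see denumerantE. *)
Definition denumerant (a : nat -> nat) (k n : nat) : nat :=
  #|[set x : {ffun 'I_k -> 'I_n.+1} | \sum_(i < k) a i.+1 * x i == n]|.

Lemma denumerantE (a : nat -> nat) (k n : nat) (s : seq {ffun 'I_k -> nat}) :
    (forall i, 0 < i -> 0 < a i) -> uniq s ->
    (forall x : {ffun 'I_k -> nat},
       (x \in s) = (\sum_(i < k) a i.+1 * x i == n)) ->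
  denumerant a k n = size s.
Proof.
move=> a_gt0 s_uniq sE.
pose F (x : {ffun 'I_k -> 'I_n.+1}) : {ffun 'I_k -> nat} :=
  [ffun i => nat_of_ord (x i)].
have F_inj : injective F.
  by move=> x y /ffunP xy; apply/ffunP => i; apply/val_inj; have := xy i;
     rewrite !ffunE.
have FE x : \sum_(i < k) a i.+1 * F x i = \sum_(i < k) a i.+1 * x i.
  by apply: eq_bigr => i _; rewrite ffunE.
rewrite /denumerant cardE -(size_map F); apply/perm_size/uniq_perm => //.
  by rewrite map_inj_uniq ?enum_uniq.
move=> y; rewrite sE; apply/mapP/eqP => [[x] | yn].
  by rewrite mem_enum inE -FE => /eqP xn ->.
have le_yn i : y i < n.+1.
  rewrite ltnS -yn (bigD1 i) //=; apply: leq_trans (leq_addr _ _).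
  by rewrite leq_pmull // a_gt0.
exists [ffun i => Ordinal (le_yn i)].
  rewrite mem_enum inE -FE -[X in _ == X]yn; apply/eqP/eq_bigr => i _.
  by rewrite !ffunE.
by apply/ffunP => i; rewrite !ffunE.
Qed.

Local Open Scope ring_scope.

Fixpoint blom_froberg_nat (a : nat -> nat) (r m : nat) (l : int) : rat :=
  match m with
  | 0%N => if l == 0 then 1 else 0
  | m'.+1 =>
      if (l < 0) || (m%:Z < l) then 0
      else blom_froberg_nat a r m' l
           + (a (m + r)%N)%:R / 2%:R * blom_froberg_nat a r m' (l - 1)
  end.

(* For m < 0, every l satisfies l < 0 or l > m. *)
Definition blom_froberg (a : nat -> nat) (r : nat) (m l : int) : rat :=
  match m with
  | Posz m' => blom_froberg_nat a r m' l
  | Negz _ => 0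
  end.

Lemma blom_froberg_out a r (m l : int) :
  (l < 0) || (m < l) -> blom_froberg a r m l = 0.
Proof.
case: m => [[|m]|m] //= H; last by rewrite H.
by case: eqP H => // ->; rewrite ltxx.
Qed.

Lemma blom_froberg00 a r : blom_froberg a r 0 0 = 1.
Proof. by []. Qed.

Lemma blom_froberg_rec a r (m l : int) :
    ~~ ((l < 0) || (m < l)) -> (m, l) != (0, 0) ->
  blom_froberg a r m l =
    blom_froberg a r (m - 1) l
    + (a (absz (m + r%:Z)))%:R / 2%:R * blom_froberg a r (m - 1) (l - 1).
Proof.
case: m => [[|m]|m] => H nz.
- case/negP: nz; rewrite xpair_eqE eqxx /=.
  by move: H; rewrite negb_or -!leNgt -eq_le eq_sym.
- have -> : m.+1%:Z - 1 = m by rewrite -addn1 PoszD addrK.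
  by rewrite /= (negPf H).
- by case/negP: H; case: l {nz}.
Qed.

Definition gcd_prefix (a : nat -> nat) (i : nat) : nat :=
  \big[gcdn/0%N]_(1 <= j < i.+1) a j.

(* The value at 0 is a dummy. The quotient of consecutive prefix gcds is an
   exact division. *)
Fixpoint s_minus (a : nat -> nat) (i : nat) : int :=
  match i with
  | 0%N => 0
  | 1%N => - (a 1%N)%:Z
  | (i'.+1 as j).+1 =>
      s_minus a j
      + ((gcd_prefix a j %/ gcd_prefix a j.+1)%N%:Z - 1) * (a j.+1)%:Z
  end.

(* Main.v *)
Require Import Defs.
From mathcomp Require Import all_boot all_order all_algebra.
From mathcomp Require Import zify ring lra.
Import Order.TTheory GRing.Theory Num.Theory.
Local Open Scope ring_scope.

(** Let [P k] be the claimed lower bound at [gcd_prefix a k = 1], as a polynomial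
    in [t = n - s_minus a k]. The Blom-Froberg recursion says that
    [a k.+1 * P k.+1] is the antiderivative of [P k] vanishing at [0] plus
    [a k.+1 / 2 * P k]. With [d = gcd_prefix a k], one shows by induction on [k]
    that [d * P k (n - s_minus a k)] bounds the denumerant below for all
    multiples [n >= s_minus a k] of [d]. Fixing the last unknown gives
    [D k.+1 n] as the sum of the [D k (n - a k.+1 * x)]. The nonzero terms have
    [x] in one residue class modulo [q = d / gcd_prefix a k.+1], so they
    sample [P k] with step [h = q * a k.+1], and the trapezoidal rule for the
    convex function [P k] compares their sum with the integral. The smallest
    such [x] is at most [q - 1], which accounts for the increment of
    [s_minus]. *)

(** * Splitting solutions by their last unknown; prefix gcds *)

Section Denumerant.
Local Open Scope nat_scope.
Variable a : nat -> nat.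
Hypothesis a_gt0 : forall i, 0 < i -> 0 < a i.

Definition solution {k} (n : nat) (x : {ffun 'I_k -> nat}) :=
  \sum_(i < k) a i.+1 * x i == n.

(** Unbounded coordinates put the solutions for all [n] into one type, where they can be
    compared. *)
Definition solutions k n : seq {ffun 'I_k -> nat} :=
  [seq [ffun i => nat_of_ord (x i)] |
    x : {ffun 'I_k -> 'I_n.+1} <-
      enum [set x : {ffun 'I_k -> 'I_n.+1} | \sum_(i < k) a i.+1 * x i == n]].

Lemma solutions_uniq k n : uniq (solutions k n).
Proof.
rewrite map_inj_uniq ?enum_uniq // => x y /ffunP xy; apply/ffunP => i.
by apply/val_inj; have := xy i; rewrite !ffunE.
Qed.

Lemma size_solutions k n : size (solutions k n) = denumerant a k n.
Proof. by rewrite size_map -cardE. Qed.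

Lemma mem_solutions k n (x : {ffun 'I_k -> nat}) :
  (x \in solutions k n) = solution n x.
Proof.
apply/mapP/eqP => [[y] | xn].
  rewrite mem_enum inE => /eqP yn ->; rewrite -[RHS]yn.
  by apply: eq_bigr => i _; rewrite ffunE.
have le_xn i : x i < n.+1.
  rewrite ltnS -xn (bigD1 i) //=; apply: leq_trans (leq_addr _ _).
  by rewrite leq_pmull ?a_gt0.
exists [ffun i => Ordinal (le_xn i)]; last by apply/ffunP => i; rewrite !ffunE.
rewrite mem_enum inE; apply/eqP; rewrite -[RHS]xn.
by apply: eq_bigr => i _; rewrite ffunE.
Qed.

Lemma leq_denumerant k n (s : seq {ffun 'I_k -> nat}) :
  uniq s -> {in s, forall x, solution n x} -> size s <= denumerant a k n.
Proof.
move=> s_uniq sP; rewrite -size_solutions; apply: uniq_leq_size => // x xs.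
by rewrite mem_solutions sP.
Qed.

Definition append0 {k} (x : {ffun 'I_k -> nat}) : {ffun 'I_k.+1 -> nat} :=
  [ffun i => if unlift ord_max i is Some j then x j else 0].

Definition incr_last {k} (x : {ffun 'I_k.+1 -> nat}) : {ffun 'I_k.+1 -> nat} :=
  [ffun i => (i == ord_max) + x i].

Lemma append0_inj k : injective (@append0 k).
Proof.
move=> x y /ffunP xy; apply/ffunP => i; have := xy (lift ord_max i).
by rewrite !ffunE liftK.
Qed.

Lemma incr_last_inj k : injective (@incr_last k).
Proof.
by move=> x y /ffunP xy; apply/ffunP => i; have := xy i; rewrite !ffunE => /addnI.
Qed.

Lemma solution_append0 k n (x : {ffun 'I_k -> nat}) :
  solution n (append0 x) = solution n x.
Proof.
rewrite /solution big_ord_recr /= ffunE unlift_none muln0 addn0; congr (_ == _).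
apply: eq_bigr => i _; rewrite ffunE.
have -> : widen_ord (leqnSn k) i = lift ord_max i.
  by apply/val_inj; rewrite /= /bump leqNgt ltn_ord.
by rewrite liftK.
Qed.

Lemma solution_incr_last k n (x : {ffun 'I_k.+1 -> nat}) :
  solution n x -> solution (a k.+1 + n) (incr_last x).
Proof.
move=> /eqP <-; rewrite /solution !big_ord_recr /= ffunE eqxx mulnDr muln1.
rewrite addnCA eqn_add2l; apply/eqP; congr (_ + _); apply: eq_bigr => i _.
by rewrite ffunE -val_eqE /= ltn_eqF.
Qed.

Lemma leq_denumerantS k n : denumerant a k n <= denumerant a k.+1 n.
Proof.
rewrite -size_solutions -(size_map append0); apply: leq_denumerant.
  by rewrite map_inj_uniq ?solutions_uniq //; apply: append0_inj.
by move=> _ /mapP[x + ->]; rewrite solution_append0 mem_solutions.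
Qed.

(** The images of [append0] and [incr_last] are disjoint: the last unknown is zero in the first and
    positive in the second. *)
Lemma denumerantD k n :
  denumerant a k (a k.+1 + n) + denumerant a k.+1 n <= denumerant a k.+1 (a k.+1 + n).
Proof.
rewrite -!size_solutions -(size_map append0) -(size_map incr_last (solutions k.+1 n)).
rewrite -size_cat size_solutions; apply: leq_denumerant.
  rewrite cat_uniq (map_inj_uniq (@append0_inj k)) (map_inj_uniq (@incr_last_inj k)).
  rewrite !solutions_uniq andbT; apply/hasPn => _ /mapP[x _ ->].
  apply/mapP => -[y _ /ffunP /(_ ord_max)].
  by rewrite !ffunE unlift_none eqxx.
move=> y; rewrite mem_cat => /orP[] /mapP[x + ->]; rewrite mem_solutions.
  by rewrite solution_append0.
exact: solution_incr_last.
Qed.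

Lemma leq_denumerant_mul k n c :
  denumerant a k.+1 n <= denumerant a k.+1 (c * a k.+1 + n).
Proof.
elim: c => // c IHc; apply: leq_trans IHc _; rewrite mulSn -addnA.
exact: leq_trans (leq_addl _ _) (denumerantD _ _).
Qed.

(** Solutions whose last unknown lies strictly between [0] and [c] are dropped; where the lemma is
    applied, divisibility rules them out. *)
Lemma denumerantD_mul k n c : 0 < c ->
  denumerant a k (c * a k.+1 + n) + denumerant a k.+1 n
    <= denumerant a k.+1 (c * a k.+1 + n).
Proof.
case: c => // c _; rewrite mulSn -addnA; apply: leq_trans (denumerantD _ _).
by rewrite leq_add2l leq_denumerant_mul.
Qed.

Lemma gcd_prefixS k : gcd_prefix a k.+1 = gcdn (gcd_prefix a k) (a k.+1).
Proof. by rewrite /gcd_prefix big_nat_recr. Qed.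

Lemma gcd_prefix1 : gcd_prefix a 1 = a 1.
Proof. by rewrite /gcd_prefix big_nat1. Qed.

Lemma gcd_prefix_gt0 k : 0 < gcd_prefix a k.+1.
Proof. by rewrite gcd_prefixS gcdn_gt0 (a_gt0 _ (ltn0Sn k)) orbT. Qed.

End Denumerant.

(** * Arithmetic of [s_minus] and the passage to one more unknown *)

Section SMinus.
Variable a : nat -> nat.
Hypothesis a_gt0 : forall i : nat, (0 < i)%N -> (0 < a i)%N.

Lemma s_minusS k :
  s_minus a k.+2 = s_minus a k.+1
    + ((gcd_prefix a k.+1 %/ gcd_prefix a k.+2)%N%:Z - 1) * (a k.+2)%:Z.
Proof. by []. Qed.

(** This form encodes at once divisibility by the prefix gcd [d] and the lower bound [- d]. *)
Lemma s_minusP k : exists j : nat,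
  s_minus a k.+1 = (j * gcd_prefix a k.+1)%N%:Z - (gcd_prefix a k.+1)%:Z.
Proof.
elim: k => [|k [j IH]]; first by exists 0%N; rewrite gcd_prefix1 mul0n sub0r.
rewrite s_minusS IH; set d := gcd_prefix a k.+1; set e := gcd_prefix a k.+2.
have e_gt0 : (0 < e)%N by apply: gcd_prefix_gt0.
have d_gt0 : (0 < d)%N by apply: gcd_prefix_gt0.
have A_gt0 := a_gt0 _ (ltn0Sn k.+1).
have ed : (e %| d)%N by rewrite /e gcd_prefixS dvdn_gcdl.
have eA : (e %| a k.+2)%N by rewrite /e gcd_prefixS dvdn_gcdr.
move: ed eA d_gt0 A_gt0; clearbody d e.
case/dvdnP => q -> /dvdnP[b ->]; rewrite !muln_gt0 mulnK // => /andP[q0 _] /andP[b0 _].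
case: q q0 => // q _; case: b b0 => // b _.
(* Solves [j' - 1 = (j - 1) * q.+1 + q * b.+1] for the new multiplier [j']. *)
by exists (j * q.+1 + q * b)%N; lia.
Qed.

(** A Bezout identity for [A] and [d], multiplied by [n / gcdn d A], solves [A * c = n] modulo [d];
    the solution matters only modulo [d %/ gcdn d A]. *)
Lemma bezout_residue (A d n : nat) : (0 < A)%N -> (0 < d)%N -> (gcdn d A %| n)%N ->
  exists2 c : nat, (c < d %/ gcdn d A)%N & (d%:Z %| n%:Z - (A * c)%N%:Z)%Z.
Proof.
move=> A_gt0 d_gt0 /dvdnP[m ->].
have [u v uv _] := egcdnP d A_gt0.
have e_gt0 : (0 < gcdn d A)%N by rewrite gcdn_gt0 d_gt0.
have q_gt0 : (0 < d %/ gcdn d A)%N by rewrite divn_gt0 // dvdn_leq ?dvdn_gcdl.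
exists ((u * m) %% (d %/ gcdn d A))%N; first by rewrite ltn_mod.
have dE : (d %/ gcdn d A * gcdn d A)%N = d by rewrite divnK ?dvdn_gcdl.
have AE : (A %/ gcdn d A * gcdn d A)%N = A by rewrite divnK ?dvdn_gcdr.
have := divn_eq (u * m) (d %/ gcdn d A); rewrite [gcdn A d]gcdnC in uv.
move: dE AE uv; set q := (d %/ _)%N; set b := (A %/ _)%N.
set r := ((u * m) %% q)%N; set t := ((u * m) %/ q)%N; set e := gcdn d A.
move=> dE AE uv umE; apply/dvdzP; exists (b%:Z * t%:Z - v%:Z * m%:Z).
have E1 : (u * m * A)%N = ((t * q + r) * A)%N by rewrite umE.
have E2 : (t * q * A = b * t * d)%N by rewrite -dE -[in LHS]AE; lia.
have E3 : (u * A * m = (v * d + e) * m)%N by rewrite uv.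
lia.
Qed.

(** Separates the arithmetic from the analysis: the bounds enter only through monotonicity of [g],
    its sign at [0], and the recursion [g u <= f u + g (u - h)], whose last term is replaced by [0]
    when [u <= h]. *)
Lemma denumerant_step k (f g : int -> rat) :
    let d := gcd_prefix a k.+1 in let e := gcd_prefix a k.+2 in
    let h := (a k.+2 * (d %/ e))%N%:Z in
    g 0 <= 0 ->
    (forall u v, 0 <= u -> u <= v -> g u <= g v) ->
    (forall u, 0 < u <= h -> g u <= f u) ->
    (forall u, h < u -> g u <= f u + g (u - h)) ->
    (forall n : nat, (d %| n)%N -> s_minus a k.+1 < n%:Z ->
       f (n%:Z - s_minus a k.+1) <= (denumerant a k.+1 n)%:R) ->
  forall n : nat, (e %| n)%N -> s_minus a k.+2 <= n%:Z ->
    g (n%:Z - s_minus a k.+2) <= (denumerant a k.+2 n)%:R.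
Proof.
move=> d e h g0 g_mono g_small g_large IH.
have d_gt0 : (0 < d)%N by apply: gcd_prefix_gt0.
have e_gt0 : (0 < e)%N by apply: gcd_prefix_gt0.
have A_gt0 := a_gt0 _ (ltn0Sn k.+1).
have eE : e = gcdn d (a k.+2) by rewrite /e gcd_prefixS.
have ed : (e %| d)%N by rewrite eE dvdn_gcdl.
have [j sE] := s_minusP k; rewrite -/d in sE.
have q_gt0 : (0 < d %/ e)%N by rewrite divn_gt0 // dvdn_leq.
have h_gt0 : 0 < h by rewrite /h ltz_nat muln_gt0 A_gt0.
have dh : (d %| a k.+2 * (d %/ e))%N.
  by rewrite eE -muln_divCA_gcd dvdn_mulr.
pose D n := (denumerant a k.+2 n)%:R : rat.
(* As [d] divides [s] and [s >= - d], integers above [s] in the class of [0]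
   modulo [d] are natural numbers. *)
have above (z : int) : (d%:Z %| z)%Z -> s_minus a k.+1 < z -> 0 <= z.
  move=> /dvdzP[t ->]; rewrite sE PoszM -[X in _ - X]mul1r -mulrBl.
  by rewrite ltr_pM2r // => t_gt; rewrite mulr_ge0 //; lia.
(* Multiples of [d] come first, by descent in steps of [h], itself a multiple of [d]. *)
have multiple n : (d %| n)%N -> s_minus a k.+1 <= n%:Z ->
    g (n%:Z - s_minus a k.+1) <= D n.
  elim/ltn_ind: n => n IHn dn; rewrite le_eqVlt => /predU1P[->|s_lt_n].
    by rewrite subrr (le_trans g0) ?ler0n.
  have fD := IH n dn s_lt_n.
  case: (lerP (n%:Z - s_minus a k.+1) h) => [u_le | u_gt].
    apply: le_trans (le_trans (g_small _ _) fD) _.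
      by rewrite subr_gt0 s_lt_n.
    by rewrite /D ler_nat leq_denumerantS.
  have s_lt : s_minus a k.+1 < n%:Z - h by lia.
  have /above/(_ s_lt) : (d%:Z %| n%:Z - h)%Z by rewrite rpredB.
  rewrite subr_ge0 lez_nat => h_le_n.
  apply: le_trans (g_large _ u_gt) _; set m := (n - a k.+2 * (d %/ e))%N.
  have mE : n%:Z - s_minus a k.+1 - h = m%:Z - s_minus a k.+1 by rewrite /m; lia.
  have nE : n = (d %/ e * a k.+2 + m)%N by rewrite /m; lia.
  rewrite mE (le_trans (lerD fD (IHn m _ _ _))) //; try by rewrite /m; lia.
    by rewrite dvdn_sub.
  by rewrite -natrD ler_nat nE denumerantD_mul.
(* A multiple of [e] becomes a multiple of [d] after removing [c] copies of [a k.+2]. As [c] is at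
   most [d %/ e - 1], the increment of [s_minus] absorbs the loss, and [g] is monotone. *)
move=> n en s_le_n.
have [] := @bezout_residue (a k.+2) d n A_gt0 d_gt0; first by rewrite -eE.
rewrite -eE => c c_lt dvd_d.
have s_le : n%:Z - s_minus a k.+2 <= n%:Z - (a k.+2 * c)%N%:Z - s_minus a k.+1.
  rewrite s_minusS -/d -/e; move: c_lt; set q := (d %/ e)%N; clear -A_gt0; nia.
have u_ge0 : 0 <= n%:Z - s_minus a k.+2 by rewrite subr_ge0.
have s_le' : s_minus a k.+1 <= n%:Z - (a k.+2 * c)%N%:Z by lia.
case: (leqP (a k.+2 * c) n) => [ac_le | ac_gt]; last first.
  (* Here [n - a k.+2 * c] is a negative multiple of [d], so by [above] it cannot exceed
     [s_minus a k.+1]; only the trivial bound [g 0] remains. *)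
  have -> : n%:Z - s_minus a k.+2 = 0.
    case: (ltrP (s_minus a k.+1) (n%:Z - (a k.+2 * c)%N%:Z)) => [/above|]; last by lia.
    by move=> /(_ dvd_d); lia.
  by rewrite (le_trans g0) ?ler0n.
have mE : n%:Z - (a k.+2 * c)%N%:Z = (n - a k.+2 * c)%N%:Z by lia.
rewrite mE in dvd_d s_le s_le'.
apply: le_trans (g_mono _ _ u_ge0 s_le) (le_trans (multiple _ dvd_d s_le') _).
rewrite /D ler_nat; apply: leq_trans (leq_denumerant_mul _ a_gt0 _ _ c) _.
by rewrite mulnC subnKC.
Qed.

End SMinus.

(** * Blom-Froberg polynomials and the trapezoidal rule *)

Section BlomFroberg.
Variable a : nat -> nat.
Implicit Types (m i l : nat) (t u v : rat).

Lemma blom_froberg_ge0 m (l : int) : 0 <= blom_froberg a 2 m%:Z l.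
Proof.
rewrite /=; elim: m l => [|m IHm] l /=; first by case: ifP.
case: ifP => // _; rewrite addr_ge0 ?IHm // mulr_ge0 ?IHm //.
by rewrite divr_ge0 ?ler0n.
Qed.

Lemma blom_frobergS m l : (l <= m.+1)%N ->
  blom_froberg a 2 m.+1%:Z l%:Z = blom_froberg a 2 m%:Z l%:Z
    + (a m.+3)%:R / 2%:R * blom_froberg a 2 m%:Z (l%:Z - 1).
Proof. by move=> lm; rewrite blom_froberg_rec //= ?addn2 ?subn1 //; lia. Qed.

(* [bf_sum j m] is the [j]-fold antiderivative of
   [\sum_(i <= m) B(m, i) t ^ (m - i) / (m - i)!] vanishing at [0]. *)
Definition bf_sum j m t : rat :=
  \sum_(0 <= i < m.+1)
     blom_froberg a 2 m%:Z i%:Z * (t ^+ (m + j - i) / ((m + j - i)`!)%:R).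

Lemma bf_sumS m t :
  bf_sum 1 m.+1 t = bf_sum 2 m t + (a m.+3)%:R / 2%:R * bf_sum 1 m t.
Proof.
rewrite /bf_sum; pose T i := t ^+ (m.+2 - i) / ((m.+2 - i)`!)%:R : rat.
rewrite (eq_big_nat _ _ (F2 := fun i => blom_froberg a 2 m%:Z i%:Z * T i
    + (a m.+3)%:R / 2%:R * blom_froberg a 2 m%:Z (i%:Z - 1) * T i)); last first.
  by move=> i im; rewrite blom_frobergS // mulrDl addn1.
rewrite big_split /=; congr (_ + _).
  (* Each sum has one term too many, [i = m.+1] here and [i = 0] in the other; both carry an
     out-of-range Blom-Froberg number. *)
  rewrite big_nat_recr //= (_ : blom_froberg_nat _ _ _ _ = 0) ?mul0r ?addr0.
    by rewrite addn2.
  by apply: (blom_froberg_out a 2 (m := m%:Z)); rewrite ltz_nat ltnSn orbT.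
rewrite big_nat_recl //= (_ : blom_froberg_nat _ _ _ _ = 0); last first.
  exact: (blom_froberg_out a 2 (m := m%:Z)).
rewrite mulr0 mul0r add0r big_distrr /=; apply: eq_bigr => i _.
rewrite -mulrA /T subSS addn1; congr (_ * (blom_froberg_nat _ _ _ _ * _)).
by rewrite -addn1 PoszD addrK.
Qed.

Lemma bf_sum0 j m : bf_sum j.+1 m 0 = 0.
Proof.
rewrite /bf_sum big_nat big1 // => i /andP[_ im].
by rewrite addnS subSn ?expr0n ?mul0r ?mulr0 //; lia.
Qed.

Lemma bf_sum_mono j m u v : 0 <= u -> u <= v -> bf_sum j m u <= bf_sum j m v.
Proof.
move=> u0 uv; apply: ler_sum => i _; apply: ler_wpM2l; first exact: blom_froberg_ge0.
by apply: ler_wpM2r; rewrite ?invr_ge0 ?ler0n // lerXn2r // nnegrE (le_trans u0).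
Qed.

(** After factoring out [u - v], pair the terms of index [i] and [n - i]: the defect is [(u ^+ i - v
    ^+ i) * (u ^+ (n - i) - v ^+ (n - i))], a product of nonnegative factors. *)
Lemma trapezoid_expr n u v : 0 <= v -> v <= u ->
  u ^+ n.+1 - v ^+ n.+1 <= (u - v) * (n.+1%:R / 2%:R * (u ^+ n + v ^+ n)).
Proof.
move=> v0 vu; have u0 := le_trans v0 vu.
rewrite subrXX; apply: ler_wpM2l; first by rewrite subr_ge0.
rewrite mulrAC ler_pdivlMr ?ltr0n // mulr_natr mulr2n.
rewrite {1}(reindex_inj rev_ord_inj) /= -big_split /=.
rewrite [leRHS](_ : _ = \sum_(i < n.+1) (u ^+ n + v ^+ n)); last first.
  by rewrite sumr_const card_ord mulr_natl.
apply: ler_sum => i _; have /subnKC nE : (i <= n)%N by rewrite -ltnS.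
rewrite !subSS subKn; last by rewrite -ltnS.
rewrite -[in leRHS]nE !exprD -subr_ge0.
have -> : u ^+ i * u ^+ (n - i) + v ^+ i * v ^+ (n - i)
    - (u ^+ i * v ^+ (n - i) + u ^+ (n - i) * v ^+ i)
  = (u ^+ i - v ^+ i) * (u ^+ (n - i) - v ^+ (n - i)) by ring.
by rewrite mulr_ge0 // subr_ge0 lerXn2r.
Qed.

(* The trapezoidal rule overestimates the integral of a convex function. *)
Lemma bf_sum_trapezoid m u v : 0 <= v -> v <= u ->
  bf_sum 2 m u - bf_sum 2 m v <= (u - v) / 2%:R * (bf_sum 1 m u + bf_sum 1 m v).
Proof.
move=> v0 vu; rewrite /bf_sum -sumrB -big_split /= big_distrr /=.
rewrite !big_nat; apply: ler_sum => i /andP[_ im].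
rewrite -mulrBr -mulrDr mulrCA; apply: ler_wpM2l; first exact: blom_froberg_ge0.
have -> : (m + 2 - i = (m + 1 - i).+1)%N by lia.
set n := (m + 1 - i)%N; rewrite -mulrBl -mulrDl factS natrM.
have f0 : 0 < (n`!)%:R :> rat by rewrite ltr0n fact_gt0.
rewrite ler_pdivrMr ?mulr_gt0 ?ltr0n ?fact_gt0 //.
apply: le_trans (trapezoid_expr _ _ _ v0 vu) _.
by rewrite le_eqVlt; apply/orP; left; apply/eqP; field; rewrite gt_eqF.
Qed.

End BlomFroberg.

(** * Induction on the number of unknowns *)

(** Arbitrary prefix gcds are allowed because shorter prefixes of a coprime family need not be
    coprime. *)
Lemma denumerant_ge (a : nat -> nat) (a_gt0 : forall i : nat, (0 < i)%N -> (0 < a i)%N)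
    (m n : nat) :
  (gcd_prefix a m.+2 %| n)%N -> s_minus a m.+2 <= n%:Z ->
  (gcd_prefix a m.+2)%:R / (\prod_(1 <= i < m.+3) (a i)%:R)
     * bf_sum a 1 m (n%:Z - s_minus a m.+2)%:~R <= (denumerant a m.+2 n)%:R.
Proof.
have P_gt0 k : 0 < \prod_(1 <= i < k) (a i)%:R :> rat.
  by rewrite big_nat; apply: prodr_gt0 => i /andP[i0 _]; rewrite ltr0n a_gt0.
have d_gt0 k : 0 < (gcd_prefix a k.+1)%:R :> rat by rewrite ltr0n gcd_prefix_gt0.
pose c k : rat := (gcd_prefix a k)%:R / \prod_(1 <= i < k.+1) (a i)%:R.
have c_gt0 k : 0 < c k.+1 by rewrite divr_gt0.
have A_gt0 k : 0 < (a k.+1)%:R :> rat by rewrite ltr0n a_gt0.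
pose q k := (gcd_prefix a k.+1 %/ gcd_prefix a k.+2)%N.
have q_gt0 k : (0 < q k)%N.
  rewrite /q divn_gt0 ?(gcd_prefix_gt0 _ a_gt0 k.+1) //.
  apply: dvdn_leq; first exact: gcd_prefix_gt0 _ a_gt0 k.
  by rewrite (gcd_prefixS a k.+1) dvdn_gcdl.
(* Consecutive normalizing constants differ by exactly the sampling step [h]. *)
have cS k : c k.+1 = c k.+2 * (a k.+2 * q k)%:R.
  rewrite /c [in RHS]big_nat_recr //= natrM.
  have -> : (gcd_prefix a k.+1)%:R = (q k)%:R * (gcd_prefix a k.+2)%:R :> rat.
    by rewrite -natrM divnK // (gcd_prefixS a k.+1) dvdn_gcdl.
  by field; rewrite (gt_eqF (P_gt0 _)) gt_eqF.
rewrite -/(c m.+2); elim: m n => [|m IHm] n.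
  (* With one unknown, every multiple of [a 1] has a solution, so [f] is the constant [1]; [g] is
     linear with value [1] at [h]. *)
  pose g (u : int) : rat := c 2%N * bf_sum a 1 0 u%:~R.
  have gE u : g u = c 2%N * u%:~R.
    by rewrite /g /bf_sum big_nat1 blom_froberg00 mul1r expr1 divr1.
  have c1 : c 2%N * (a 2%N * q 0%N)%:R = 1.
    by rewrite -cS /c gcd_prefix1 big_nat1 divff // gt_eqF.
  apply: (@denumerant_step a a_gt0 0 (fun=> 1) g).
  - by rewrite gE mulr0.
  - by move=> u v _ uv; rewrite !gE ler_pM2l ?ler_int.
  - move=> u /andP[_ uh]; rewrite gE -[leRHS]c1 ler_pM2l //.
    rewrite [leRHS]pmulrn ler_int; exact: uh.
  - move=> u _; rewrite !gE -/(q 0%N) rmorphB /= mulrBr -pmulrn c1.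
    by rewrite addrC subrK.
  - move=> k dk _; rewrite ler1n.
    apply: (@leq_denumerant a a_gt0 1 k [:: [ffun=> (k %/ a 1%N)%N]]) => // x.
    rewrite inE => /eqP ->; rewrite /solution big_ord1 ffunE mulnC divnK //.
    by rewrite -gcd_prefix1.
pose f (u : int) : rat := c m.+2 * bf_sum a 1 m u%:~R.
pose g (u : int) : rat := c m.+3 * bf_sum a 1 m.+1 u%:~R.
(* Write [h] for [a m.+3 * q m.+1]. The trapezoid contributes at most [h / 2 * (Gu + Gv)] and the
   other term at most [h / 2 * (Gu - Gv)], together [h * Gu]. Allowing [u - v] below [h] covers
   [u <= h] with [v = 0]. *)
have step (u v : rat) : 0 <= v -> v <= u -> u - v <= (a m.+3 * q m.+1)%:R ->
    c m.+3 * bf_sum a 1 m.+1 u <= c m.+2 * bf_sum a 1 m u + c m.+3 * bf_sum a 1 m.+1 v.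
  move=> v0 vu uv_le; rewrite (cS m.+1) -mulrA -mulrDr ler_pM2l // !bf_sumS.
  have := bf_sum_trapezoid a m u v v0 vu.
  have := bf_sum_mono a 1 m _ _ v0 vu.
  have := bf_sum_mono a 1 m _ _ (lexx 0) v0; rewrite bf_sum0.
  set Gu := bf_sum a 1 m u; set Gv := bf_sum a 1 m v => Gv0 Guv T.
  have H1 : (u - v) / 2 * (Gu + Gv) <= (a m.+3 * q m.+1)%:R / 2 * (Gu + Gv).
    by apply: ler_wpM2r; [rewrite addr_ge0 // (le_trans Gv0) | lra].
  have H2 : (a m.+3)%:R / 2 * (Gu - Gv) <= (a m.+3 * q m.+1)%:R / 2 * (Gu - Gv).
    apply: ler_wpM2r; first by rewrite subr_ge0.
    by apply: ler_wpM2r; rewrite // ler_nat leq_pmulr.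
  move: T H1 H2; lra.
apply: (@denumerant_step a a_gt0 m.+1 f g).
- by rewrite /g bf_sum0 mulr0.
- move=> u v u0 uv; rewrite /g ler_pM2l // bf_sum_mono ?ler_int //.
  by rewrite ler0z.
- move=> u /andP[u0 uh]; have := step u%:~R 0 (lexx 0).
  rewrite bf_sum0 mulr0 addr0 subr0; apply; first by rewrite ler0z ltW.
  rewrite [leRHS]pmulrn ler_int; exact: uh.
- move=> u hu; apply: step; rewrite ?ler0z ?subr_ge0 ?ler_int ?(ltW hu) //.
    by rewrite gerBl.
  by rewrite rmorphB /= opprB addrC subrK.
- by move=> k dk /ltW; apply: IHm.
Qed.

Theorem lemma4p2 (a : nat -> nat) (k n : nat)
    (a_gt0 : forall i : nat, (0 < i)%N -> (0 < a i)%N)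
    (k_ge2 : (2 <= k)%N)
    (gcd1 : gcd_prefix a k = 1%N)
    (n_ge : s_minus a k <= n%:Z) :
  (\prod_(1 <= i < k.+1) (a i)%:R)^-1 *
    (\sum_(0 <= i < (k - 2).+1)
       blom_froberg a 2 (k - 2)%N%:Z i%:Z *
       ((n%:Z - s_minus a k)%:~R ^+ (k - 1 - i)%N / ((k - 1 - i)`!)%:R))
  <= (denumerant a k n)%:R :> rat.
Proof.
case: k k_ge2 gcd1 n_ge => [|[|m]] // _ gcd1 n_ge.
have := denumerant_ge a a_gt0 m n; rewrite gcd1 div1r dvd1n => /(_ isT n_ge).
by rewrite /bf_sum !subSS !subn0 addn1.
Qed.
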